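(* Let $L>0$, $d\ge 1$, $p\ge1$ and $\alpha>0$. Let $\mathcal{F}$ be the family of all convex $L$-smooth functions $f:\mathbb{R}^d\to\mathbb{R}$ admitting at least one minimizer, with side-information $I(f)=\{L\}$ for every $f\in\mathcal{F}$. If the iteration complexity of a given stationary first-order $p$-CLI optimization algorithm over $(\mathcal{F},I)$ is $$O\left(\sqrt[\alpha]{L/\epsilon}\right),$$ then $\alpha\le 1$.
   Context: **Smoothness.** $f$ is $L$-smooth if $\|\nabla f(x)-\nabla f(y)\|\le L\|x-y\|$ for all $x,y$. **Class of optimization problems.** A pair $\mathcal{C}=(\mathcal{F},I)$, where $\mathcal{F}$ is a family of functions on a common domain $\mathrm{dom}(\mathcal{C})$ (here $\mathbb{R}^d$) and $I$ maps each $f\in\mathcal{F}$ to a side-information element. **Stationary first-order $p$-CLI.** A first-order $p$-CLI is an algorithm which, given $f\in\mathcal{F}$ and arbitrary initialization points $x^{(0)}_1,\dots,x^{(0)}_p\in\mathrm{dom}(\mathcal{C})$, generates points satisfying, for $i=1,\dots,p$ and $k=0,1,\dots$, $$x^{(k+1)}_i\in\sum_{j=1}^p\left(A^{(k)}_{ij}\,\partial f+B^{(k)}_{ij}\right)(x^{(k)}_j),$$ where the coefficients $A^{(k)}_{ij},B^{(k)}_{ij}$ are linear operators on $\mathbb{R}^d$ ($d\times d$ matrices) and $\partial f$ is the subdifferential (here $\partial f(x)=\{\nabla f(x)\}$). Here $(A\,\partial f+B)(x)$ means $A\,\partial f(x)+Bx$. It is *stationary* if the coefficients depend exclusively on the side-information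 $I(f)$ (here: only on $L$); in particular they do not depend on $k$. The point returned after $k$ iterations is $x^{(k)}_p$. **Iteration complexity.** The minimal $K$ such that $f(x^{(k)}_p)-\min_x f(x)<\epsilon$ for all $k\ge K$, uniformly over $f\in\mathcal{F}$. The dependence on initialization is suppressed: the constant in $O(\cdot)$ may depend on the distance of the initialization points from a minimizer, so the rate is equivalently a bound of the type $f(x^{(k)}_p)-f^*\le CL\|\bar{x}^0-x^*\|^2/k^{\alpha}$ for the algorithm initialized at $\bar x^0$, with $f^*=\min f$, $x^*$ a minimizer and $C>0$ a constant. *)

(* Defs.v *)
From HB Require Import structures.
From mathcomp Require Import all_boot all_order all_algebra.
From mathcomp Require Import all_classical all_reals all_analysis.

Set Implicit Arguments.
Unset Strict Implicit.
Unset Printing Implicit Defensive.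

Import Order.TTheory GRing.Theory Num.Theory.
Import numFieldNormedType.Exports.

Local Open Scope classical_set_scope.
Local Open Scope ring_scope.

(* Points of R^d are column vectors. The library norm `|x| on matrices is the
   sup norm, so the Euclidean structure is introduced here. *)
Definition dotp (R : realType) (d : nat) (u v : 'cV[R]_d) : R :=
  \sum_(i < d) u i 0 * v i 0.

Definition enorm (R : realType) (d : nat) (u : 'cV[R]_d) : R :=
  Num.sqrt (dotp u u).

(* Only meaningful where [f] is differentiable. *)
Definition gradient (R : realType) (d : nat) (f : 'cV[R]_d -> R)
    (x : 'cV[R]_d) : 'cV[R]_d :=
  \col_i 'D_(delta_mx i 0) f x.

Definition smooth (R : realType) (d : nat) (L : R) (f : 'cV[R]_d -> R) : Prop :=
  (forall x, differentiable f x) /\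
  (forall x y, enorm (gradient f x - gradient f y) <= L * enorm (x - y)).

Definition subdifferential (R : realType) (d : nat) (f : 'cV[R]_d -> R)
    (x : 'cV[R]_d) : set 'cV[R]_d :=
  [set g | forall y, f x + dotp g (y - x) <= f y].

Definition minimizer (R : realType) (d : nat) (f : 'cV[R]_d -> R)
    (xs : 'cV[R]_d) : Prop :=
  forall y, f xs <= f y.

(* A class (F, I) of optimization problems with domain R^d; the values of
   [side_info] outside [family] are irrelevant. *)
Record problem_class (R : realType) (d : nat) := ProblemClass {
  family : set ('cV[R]_d -> R);
  info : Type;
  side_info : ('cV[R]_d -> R) -> info
}.

Definition convex_smooth_class (R : realType) (d : nat) (L : R) :
    problem_class R d :=
  {| family := [set f | [/\ convex_function [set: 'cV[R]_d] f, smooth L f &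
                           exists xs, minimizer f xs]];
     info := set R;
     side_info := fun=> [set L] |}.

(* The coefficients of a p-CLI in full generality: [coefA alg f x0 k i j] is
   A_ij^(k) for the problem [f] and the initialization points [x0]. *)
Record pCLI (R : realType) (d p : nat) := PCLI {
  coefA : ('cV[R]_d -> R) -> ('I_p -> 'cV[R]_d) -> nat ->
          'I_p -> 'I_p -> 'M[R]_d;
  coefB : ('cV[R]_d -> R) -> ('I_p -> 'cV[R]_d) -> nat ->
          'I_p -> 'I_p -> 'M[R]_d
}.

Definition stationary (R : realType) (d p : nat) (C : problem_class R d)
    (alg : pCLI R d p) : Prop :=
  exists A B : info C -> 'I_p -> 'I_p -> 'M[R]_d,
  forall f, family C f -> forall x0 k,
    coefA alg f x0 k = A (side_info C f) /\
    coefB alg f x0 k = B (side_info C f).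

(* The set (A (subdifferential f) + B)(x). *)
Definition affine_subdiff (R : realType) (d : nat) (A B : 'M[R]_d)
    (f : 'cV[R]_d -> R) (x : 'cV[R]_d) : set 'cV[R]_d :=
  [set A *m g + B *m x | g in subdifferential f x].

Definition set_sum (R : realType) (d p : nat) (S : 'I_p -> set 'cV[R]_d) :
    set 'cV[R]_d :=
  [set \sum_(j < p) y j | y in [set y : 'I_p -> 'cV[R]_d | forall j, S j (y j)]].

(* [x k i] is x_i^(k); the initialization points [x 0] are arbitrary. *)
Definition generates (R : realType) (d p : nat) (alg : pCLI R d p)
    (f : 'cV[R]_d -> R) (x : nat -> 'I_p -> 'cV[R]_d) : Prop :=
  forall k i,
    set_sum (fun j => affine_subdiff (coefA alg f (x 0%N) k i j)
                                     (coefB alg f (x 0%N) k i j) f (x k j))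
            (x k.+1 i).

Definition last_ord (p : nat) (hp : (0 < p)%N) : 'I_p :=
  Ordinal (etrans (ltn_predL p) hp).

(* The least K such that f(x_p^(k)) - min f < eps for all k >= K, uniformly over
   the family and over all runs whose initialization points lie within distance
   [r] of a common minimizer; it is +oo if there is no such K. *)
Definition iteration_complexity (R : realType) (d p : nat) (hp : (0 < p)%N)
    (C : problem_class R d) (alg : pCLI R d p) (r eps : R) : \bar R :=
  ereal_inf [set (K%:R)%:E | K in [set K : nat |
    forall (f : 'cV[R]_d -> R) (xs : 'cV[R]_d) (x : nat -> 'I_p -> 'cV[R]_d),
      family C f -> minimizer f xs -> generates alg f x ->
      (forall i, enorm (x 0%N i - xs) <= r) ->
      forall k, (K <= k)%N -> f (x k (last_ord hp)) - f xs < eps]].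

(* The complexity is O(phi(eps)) as eps -> 0+, the constant (and the range of
   eps) being allowed to depend on the distance [r] from the initialization
   points to a minimizer. *)
Definition complexity_bigO (R : realType) (d p : nat) (hp : (0 < p)%N)
    (C : problem_class R d) (alg : pCLI R d p) (phi : R -> R) : Prop :=
  forall r : R, 0 < r -> exists2 c : R, 0 < c &
    \forall eps \near 0^'+,
      (iteration_complexity hp C alg r eps <= (c * phi eps)%:E)%E.

(* Main.v *)
(** Run the algorithm from the origin on the quadratics [mu / 2 * |x - c|^2] with
    [0 < mu < L] and [|c| = 1]. By stationarity the error of the returned point
    in a fixed coordinate is a polynomial [rho_k(mu)] with [rho_k(0)^2 = 1],
    and the sequence [rho_k^2] satisfies a linear recurrence whose coefficients
    are polynomials in [mu] not depending on [k] (Cayley-Hamilton). Hence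
    [S(mu) = \sum_k rho_k(mu)^2], where it converges, is a rational function of
    [mu]. If [alpha > 1], the bound [mu * rho_k(mu)^2 = O(k^-alpha)] is summable
    uniformly in [mu], so [mu * S(mu)] tends to [0] as [mu] tends to [0+]; being
    rational, [S] is then bounded near [0+]. But [S(mu)] is at least the partial
    sum of order [K], which tends to [K], for every [K]. *)

Require Import Defs.
From HB Require Import structures.
From mathcomp Require Import all_boot all_order all_algebra.
From mathcomp Require Import all_classical all_reals all_analysis.
From mathcomp Require Import ring.
Import Order.TTheory GRing.Theory Num.Theory.
Import numFieldNormedType.Exports.
Local Open Scope classical_set_scope.
Local Open Scope ring_scope.

(** * Linear recurrences as polynomials in the shift *)

(** This is [c] evaluated at the shift operator and applied to [a]; its vanishing for all [k] is the
    linear recurrence with characteristic polynomial [c]. *)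
Definition shift_op {K : comNzRingType} (c : {poly K}) (a : nat -> K) (k : nat) : K :=
  \sum_(m < size c) c`_m * a (k + m)%N.

(** By Cayley-Hamilton the characteristic polynomial of the transition matrix annihilates every
    coordinate at once; being monic, it is nonzero. An arbitrary finite index type allows pairs of
    states as indices. *)
Lemma linear_recurrence {K : comNzRingType} {I : finType} (T : I -> I -> K)
    (y : nat -> I -> K) :
  (forall k i, y k.+1 i = \sum_j T i j * y k j) ->
  exists2 c : {poly K}, c != 0 & forall i k, shift_op c (y^~ i) k = 0.
Proof.
move=> yS; case cardI: #|I| => [|n].
  exists 1; first exact: oner_neq0.
  by move=> i; have := card0_eq cardI i.
pose e (m : 'I_n.+1) : I := enum_val (cast_ord (esym cardI) m).
have eK (i : I) : e (cast_ord cardI (enum_rank i)) = i.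
  by rewrite /e cast_ordK enum_rankK.
have sumE (F : I -> K) : \sum_i F i = \sum_(m < n.+1) F (e m).
  rewrite (reindex e) //; exists (fun i => cast_ord cardI (enum_rank i)) => i _ //.
  by rewrite /e enum_valK cast_ordKV.
pose A : 'M[K]_n.+1 := \matrix_(l, m) T (e l) (e m).
pose v k : 'cV[K]_n.+1 := \col_l y k (e l).
have vD k m : v (k + m)%N = A ^+ m *m v k.
  elim: m => [|m IHm]; first by rewrite addn0 expr0 mul1mx.
  rewrite addnS exprS -mulmxA -IHm; apply/matrixP => l z.
  by rewrite !mxE yS sumE; apply: eq_bigr => j _; rewrite !mxE.
exists (char_poly A); first exact/monic_neq0/char_poly_monic.
move=> i k; pose l := cast_ord cardI (enum_rank i).
have : (horner_mx A (char_poly A) *m v k) l 0 = 0.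
  by rewrite Cayley_Hamilton mul0mx mxE.
have -> : horner_mx A (char_poly A) =
    \sum_(m < size (char_poly A)) (char_poly A)`_m *: A ^+ m.
  rewrite -[in LHS](coefK (char_poly A)) poly_def linear_sum.
  by apply: eq_bigr => m _; rewrite linearZ rmorphXn /= horner_mx_X.
rewrite mulmx_suml summxE => <-; apply: eq_bigr => m _.
by rewrite -scalemxAl -vD !mxE eK.
Qed.

Lemma shift_op_widen {K : comNzRingType} (N : nat) (c : {poly K}) a k :
  (size c <= N)%N -> shift_op c a k = \sum_(m < N) c`_m * a (k + m)%N.
Proof.
move=> cN; rewrite /shift_op (big_ord_widen N (fun m => c`_m * a (k + m)%N) cN).
rewrite big_mkcond; apply: eq_bigr => m _.
by case: ltnP => // ?; rewrite nth_default ?mul0r.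
Qed.

Lemma shift_op_addn {K : comNzRingType} (c : {poly K}) a n k :
  shift_op c (fun k => a (k + n)%N) k = shift_op c a (k + n).
Proof. by apply: eq_bigr => m _; rewrite addnAC. Qed.

(** Multiplication by ['X] shifts the sequence, so the factor ['X - 1] acts as the forward
    difference. *)
Lemma shift_op_mulXsub1 {K : comNzRingType} (q : {poly K}) a k :
  shift_op (q * ('X - 1%:P)) a k = shift_op q a k.+1 - shift_op q a k.
Proof.
have sz : (size (q * ('X - 1%:P))%R <= (size q).+1)%N.
  by rewrite (leq_trans (size_polyMleq _ _)) // size_XsubC addn2.
rewrite (shift_op_widen _ _ _ _ sz) (shift_op_widen (size q).+1 q a k (leqnSn _)).
rewrite big_ord_recl /= [X in _ = _ - X]big_ord_recl /=.
under eq_bigr => m _.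
  rewrite /bump /= add1n mulrBr coefB coefMX coefMC /= mulr1 mulrBl.
  over.
rewrite sumrB mulrBr coefB coefMX coefMC /= mulr1 sub0r mulNr.
rewrite /shift_op [in RHS]opprD addrCA; congr (_ + (_ + _)).
by apply: eq_bigr => m _; rewrite addnS addSn.
Qed.

(* Characteristic roots at [1] can be divided out of the recurrence: the
   sequence obtained by dropping a factor ['X - 1] is constant, and it tends
   to [0]. *)
Lemma recurrence_not_root1 {R : realType} (L : R) (a : nat -> {poly R})
    (c : {poly {poly R}}) : 0 < L ->
  (forall mu, 0 < mu < L -> (a k).[mu] @[k --> \oo] --> 0) ->
  c != 0 -> (forall k, shift_op c a k = 0) ->
  exists2 q : {poly {poly R}}, ~~ root q 1 & forall k, shift_op q a k = 0.
Proof.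
move=> L0 a0; move: {2}(size c) (leqnn (size c)) => n.
elim: n c => [|n IHn] c; first by rewrite leqn0 size_poly_eq0 => ->.
move=> cn cN0 ca; have [/factor_theorem[q cq]|] := boolP (root c 1); last by exists c.
have qN0 : q != 0 by apply: contraNneq cN0 => q0; rewrite cq q0 mul0r.
have qb k : shift_op q a k = shift_op q a 0.
  elim: k => // k <-; apply/eqP; rewrite -subr_eq0 -shift_op_mulXsub1 -cq.
  exact/eqP.
apply: (IHn q) => //.
  by rewrite -ltnS (leq_trans _ cn) // cq size_Mmonic ?monicXsubC // size_XsubC addn2.
move=> k; rewrite qb.
have b0 mu : 0 < mu < L -> (shift_op q a 0).[mu] = 0.
  move=> muL; suff : (fun=> (shift_op q a 0).[mu]) @ \oo --> (0 : R).
    by move/(cvg_lim (@norm_hausdorff _ _)); rewrite lim_cst //; exact: norm_hausdorff.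
  have -> : (fun=> (shift_op q a 0).[mu]) =
      (fun k : nat => \sum_(m < size q) (q`_m).[mu] * (a (k + m)%N).[mu]).
    apply/funext => j; rewrite -(qb j) /shift_op horner_sum.
    by apply: eq_bigr => m _; rewrite hornerM.
  rewrite -[X in _ --> X](@big1_eq _ _ +%R _ (index_enum 'I_(size q)) xpredT).
  apply: cvg_big => [|m _]; first exact: add_continuous.
  rewrite -[X in _ --> X](mulr0 (q`_m).[mu]); apply: cvgMl_tmp.
  by move/a0: muL; rewrite -(cvg_shiftn m).
apply/eqP/contraT => bN0.
(* These are distinct points of []0, L[], more than a nonzero polynomial of that size can have as
   roots. *)
pose r := [seq L / (j.+2)%:R | j <- iota 0 (size (shift_op q a 0))].
have : (size r < size (shift_op q a 0))%N.
  apply: max_poly_roots bN0 _ _.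
    apply/allP => _ /mapP[j _ ->]; apply/rootP/b0.
    by rewrite divr_gt0 //= ltr_pdivrMr // ltr_pMr // ltr1n.
  rewrite map_inj_uniq ?iota_uniq // => i j /(mulfI (lt0r_neq0 L0))/invr_inj.
  by move/(mulrIn (@oner_neq0 R)) => [].
by rewrite size_map size_iota ltnn.
Qed.

(** * Polynomials and rational functions near [0+] *)

Lemma horner_vanish_at_right {R : realType} (p : {poly R}) (e : R) :
  0 < e -> p.[0] = 0 -> \forall x \near 0^'+, `|p.[x]| < e.
Proof.
move=> e0 p0; have /cvg_at_right_filter := @continuous_horner R p 0.
rewrite p0 => /cvgr0_norm_lt; exact.
Qed.

(** A pole at [0] has integer order, and [x * P / D] tending to [0] excludes order one or more. The
    induction on the size of [D] cancels common factors ['X] until [D] does not vanish at [0]. *)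
Lemma rational_bounded_at_right {R : realType} (D P : {poly R}) : D != 0 ->
  (forall e, 0 < e -> \forall x \near 0^'+, `|x * P.[x]| <= e * `|D.[x]|) ->
  exists B, \forall x \near 0^'+, `|P.[x]| <= B * `|D.[x]|.
Proof.
move: {2}(size D) (leqnn (size D)) => n.
elim: n D P => [|n IHn] D P; first by rewrite leqn0 size_poly_eq0 => ->.
move=> Dn DN0 oP.
have cont (p : {poly R}) : p.[x] @[x --> 0^'+] --> p.[0].
  exact/cvg_at_right_filter/continuous_horner.
have [/rootP D0|D0] := boolP (root D 0); last first.
  exists ((`|P.[0]| + 1) / (`|D.[0]| / 2)).
  have D0gt : 0 < `|D.[0]| by rewrite normr_gt0.
  have /cvg_norm/cvgr_gt/(_ (`|D.[0]| / 2)) := cont D.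
  have /cvg_norm/cvgr_lt/(_ (`|P.[0]| + 1)) := cont P.
  rewrite ltrDl ltr01 ltr_pdivrMr // ltr_pMr // ltr1n => /(_ isT) ltP /(_ isT) ltD.
  near=> x; rewrite mulrAC ler_pdivlMr ?divr_gt0 //.
  apply: ler_pM => //.
    by apply: ltW; near: x.
  by apply: ltW; near: x.
have /factor_theorem[D1 DE] : root D 0 by apply/rootP.
(* With [D = D1 * 'X], cancelling [x] in the hypothesis leaves [|P| <= e1 * |D1|], and [e1] is
   chosen to make the right side at most [e] near [0]. *)
have P0 : P.[0] = 0.
  have cP : `|P.[x]| @[x --> 0^'+] --> `|P.[0]| by apply: cvg_norm; exact: cont.
  have cD : `|D1.[x]| @[x --> 0^'+] --> `|D1.[0]| by apply: cvg_norm; exact: cont.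
  apply/eqP; rewrite -normr_eq0 eq_le normr_ge0 andbT.
  apply/ler_addgt0Pl => e e0; rewrite addr0.
  pose e1 := e / (`|D1.[0]| + 1).
  have e10 : 0 < e1 by rewrite divr_gt0 // ltr_wpDl.
  have -> : e = e1 * (`|D1.[0]| + 1) by rewrite mulfVK // gt_eqF // ltr_wpDl.
  apply: (@cvgr_to_le _ _ _ _ _ _ _ cP).
  move/cvgr_lt : cD => /(_ (`|D1.[0]| + 1)); rewrite ltrDl ltr01 => /(_ isT) ltD.
  near=> x; have x0 : 0 < `|x| by rewrite normr_gt0 gt_eqF.
  rewrite -(ler_pM2l x0) -normrM; apply: (@le_trans _ _ (e1 * `|D.[x]|)).
    by near: x; exact: oP.
  rewrite DE hornerM hornerXsubC subr0 normrM.
  have -> : e1 * (`|D1.[x]| * `|x|) = `|x| * (e1 * `|D1.[x]|) by ring.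
  rewrite ler_pM2l // ler_pM2l // ltW //; near: x; exact: ltD.
have /factor_theorem[P1 PE] : root P 0 by apply/rootP.
have D1N0 : D1 != 0 by apply: contraNneq DN0 => D10; rewrite DE D10 mul0r.
have [||B PB] := IHn D1 P1 _ D1N0.
- by rewrite -ltnS (leq_trans _ Dn) // DE size_Mmonic ?monicXsubC // size_XsubC addn2.
- move=> e e0; have := oP e e0; apply: filterS2 (nbhs_right_gt 0) => x x0.
  rewrite DE PE !hornerM !hornerXsubC subr0 mulrA !normrM mulrA.
  by rewrite ler_pM2r // normr_gt0 gt_eqF.
- exists B; near=> x; rewrite DE PE !hornerM !hornerXsubC subr0 !normrM mulrA.
  by rewrite ler_wpM2r //; near: x.
Unshelve. all: by end_near.
Qed.

Lemma horner_neq0_at_right {R : realType} (D : {poly R}) :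
  D != 0 -> \forall x \near 0^'+, D.[x] != 0.
Proof.
move=> DN0; have [m [q /implyP/(_ DN0) q0 ->]] := multiplicity_XsubC D 0.
have /cvg_at_right_filter/cvgr_neq0 := @continuous_horner R q 0.
rewrite -/(root q 0) => /(_ q0).
apply: filterS2 (nbhs_right_gt 0) => x x0 qx.
by rewrite hornerM horner_exp hornerXsubC subr0 mulf_neq0 // expf_neq0 // gt_eqF.
Qed.

(* The sum of such a sequence is a rational function of [mu]; being
   [o(1 / mu)] at [0+], it is bounded there, although its partial sums of
   order [K] tend to [K]. *)
Lemma recurrence_not_dominated {R : realType} (L : R) (a : nat -> {poly R})
    (c : {poly {poly R}}) (w : nat -> R) : 0 < L ->
  c != 0 -> (forall k, shift_op c a k = 0) ->
  (forall k, (a k).[0] = 1) ->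
  (forall mu k, 0 < mu < L -> 0 <= mu * (a k).[mu] <= w k) ->
  ~ cvgn (series w).
Proof.
move=> L0 cN0 ca a1 aw cvw.
have a_ge0 mu k : 0 < mu < L -> 0 <= (a k).[mu].
  by move=> muL; have /andP[+ _] := aw mu k muL; rewrite pmulr_rge0 //; case/andP: muL.
have w_ge0 k : 0 <= w k.
  have /(aw _ k)/andP[] : 0 < L / 2 < L by rewrite divr_gt0 //= ltr_pdivrMr // ltr_pMr // ltr1n.
  exact: le_trans.
have cva mu : 0 < mu < L -> cvgn (series (fun k => (a k).[mu])).
  move=> muL; have mu0 : 0 < mu by case/andP: muL.
  apply: (@series_le_cvg _ _ (mu^-1 *: w)) => [k|k|k|]; rewrite ?a_ge0 //.
  - by rewrite mulr_ge0 // invr_ge0 ltW.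
  - by rewrite ler_pdivlMl //; have /andP[] := aw mu k muL.
  - exact: is_cvg_seriesZ.
have [q q1 qa] : exists2 q : {poly {poly R}}, ~~ root q 1 &
    forall k, shift_op q a k = 0.
  by apply: (recurrence_not_root1 L a c) => // mu /cva /cvg_series_cvg_0.
pose psum n : {poly R} := \sum_(0 <= k < n) a k.
pose S mu : R := limn (series (fun k => (a k).[mu])).
have psumE n mu : (psum n).[mu] = series (fun k => (a k).[mu]) n.
  by rewrite horner_sum.
have psum_le n mu : 0 < mu < L -> (psum n).[mu] <= S mu.
  move=> muL; rewrite psumE; apply: nondecreasing_cvgn_le (cva _ muL) _.
  by apply: nondecreasing_series => k _ _; exact: a_ge0.
(* Summing the recurrence over all [k] gives [\sum_m q_m * (S - psum m) = 0], that is [D * S = P];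
   here [D] is nonzero because [1] is not a root of [q]. *)
pose D := q.[1]; pose P := \sum_(m < size q) q`_m * psum m.
have DSE mu : 0 < mu < L -> D.[mu] * S mu = P.[mu].
  move=> muL.
  have E0 n : \sum_(m < size q) (q`_m).[mu] * ((psum (n + m)%N).[mu] - (psum m).[mu]) = 0.
    have psumD m : psum (n + m)%N - psum m = \sum_(0 <= k < n) a (k + m)%N.
      rewrite /psum addnC (big_cat_nat (n := m)) ?leq_addr //= addrAC subrr add0r.
      by rewrite -{1}[m]add0n [(m + n)%N]addnC big_addn addnK.
    transitivity (\sum_(0 <= k < n) shift_op q a k).[mu]; last first.
      by rewrite big1 ?horner0 // => k _; exact: qa.
    rewrite /shift_op exchange_big horner_sum; apply: eq_bigr => m _.
    by rewrite -mulr_sumr hornerM -psumD hornerD hornerN.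
  have : \sum_(m < size q) (q`_m).[mu] * (S mu - (psum m).[mu]) = 0.
    suff : (fun n : nat => \sum_(m < size q) (q`_m).[mu] *
        ((psum (n + m)%N).[mu] - (psum m).[mu])) @ \oo -->
        \sum_(m < size q) (q`_m).[mu] * (S mu - (psum m).[mu]).
      move/(cvg_lim (@norm_hausdorff _ _)) => <-.
      by rewrite (funext E0) lim_cst.
    apply: cvg_big => [|m _]; first exact: add_continuous.
    apply: cvgMl_tmp; apply: cvgB; last exact: cvg_cst.
    rewrite (funext (fun n => psumE (n + m)%N mu)).
    by have := cva _ muL; rewrite /S -(cvg_shiftn m); exact.
  under eq_bigr do rewrite mulrBr.
  rewrite sumrB -mulr_suml => /eqP; rewrite subr_eq0 => /eqP SE.
  transitivity (\sum_(m < size q) (q`_m).[mu] * S mu).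
    rewrite -mulr_suml; congr (_ * _).
    rewrite /D -{1}[q]coefK horner_poly horner_sum.
    by apply: eq_bigr => m _; rewrite expr1n mulr1.
  rewrite -mulr_suml SE /P horner_sum; apply: eq_bigr => m _.
  by rewrite hornerM.
have DN0 : D != 0 by [].
have tail e : 0 < e -> exists K, limn (series w) - series w K < e.
  move=> e0; have /cvgr_gt/(_ (limn (series w) - e)) := cvw.
  rewrite gtrBl => /(_ e0)[K _ /(_ K (leqnn K)) /=] ?.
  by exists K; rewrite ltrBlDr addrC -ltrBlDr.
have w_le n : series w n <= limn (series w).
  apply: nondecreasing_cvgn_le cvw n.
  by apply: nondecreasing_series => k _ _; exact: w_ge0.
have L_near : \forall mu \near 0^'+, 0 < mu < L.
  near=> mu; apply/andP; split; near: mu; [exact: nbhs_right_gt|exact: nbhs_right_lt].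
have [e e0|B PB] := rational_bounded_at_right D P DN0.
  (* The sum is split at [K]: the tail of [mu * S] is below the tail of [w], less than [e / 2]
     uniformly in [mu], and [mu * psum K] vanishes at [0]. *)
  have [K We] : exists K, limn (series w) - series w K < e / 2 by apply: tail; rewrite divr_gt0.
  have := horner_vanish_at_right ('X * psum K) (e / 2).
  rewrite divr_gt0 // hornerM hornerX mul0r => /(_ isT erefl).
  apply: filterS2 L_near => mu muL; rewrite hornerM hornerX => muK.
  have mu0 : 0 < mu by case/andP: muL.
  rewrite -DSE // mulrCA normrM mulrC ler_wpM2r //.
  have S0 : 0 <= S mu by rewrite (le_trans _ (psum_le 0%N _ muL)) // /psum big_geq // horner0.
  rewrite ger0_norm ?mulr_ge0 // ?ltW //.
  have : S mu <= (psum K).[mu] + mu^-1 * (limn (series w) - series w K).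
    apply: limr_le; first exact: cva.
    near=> n.
    have Kn : (K <= n)%N by near: n; exact: nbhs_infty_ge.
    rewrite psumE -lerBlDl ler_pdivlMl // sub_series_geq // mulr_sumr.
    rewrite (le_trans _ (lerB (w_le n) (lexx (series w K)))) // sub_series_geq //.
    by apply: ler_sum => k _; have /andP[] := aw mu k muL.
  rewrite -(ler_pM2l mu0) mulrDr mulVKf ?gt_eqF // => /le_lt_trans -> //.
  rewrite [e]splitr ltrD // (le_lt_trans (ler_norm _)) //.
(* Since [psum K] takes the value [K > B] at [0], it exceeds [B] near [0], although it is at most
   [S = P / D]. *)
pose K := (Num.truncn B).+1.
have KB : B < (psum K).[0].
  rewrite horner_sum; under eq_bigr do rewrite a1.
  by rewrite sumr_const_nat subn0 truncnS_gt.
have /cvg_at_right_filter/cvgr_gt/(_ B KB) := @continuous_horner R (psum K) 0.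
move: PB (horner_neq0_at_right D DN0) L_near => PB DN L_near BK.
near (0:R)^'+ => mu.
have muL : 0 < mu < L by near: mu.
have DNmu : D.[mu] != 0 by near: mu.
have : `|P.[mu]| <= B * `|D.[mu]| by near: mu.
have : B < (psum K).[mu] by near: mu.
rewrite -DSE // normrM mulrC ler_pM2r ?normr_gt0 // => ltB leB.
have := lt_le_trans ltB (psum_le K _ muL).
by rewrite ltNge (le_trans (ler_norm _) leB).
Unshelve. all: by end_near.
Qed.

(** * Convergence of the Riemann series *)

(** Comparison with a telescoping series, the differences of [n^-b / b] with [b = s - 1], which
    plays the part of the integral test. *)
Lemma cvg_riemannR {R : realType} (s : R) : 1 < s -> cvgn (series (riemannR s)).
Proof.
move=> s1; pose b := s - 1; have b0 : 0 < b by rewrite subr_gt0.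
have riemannR_le n : riemannR s n.+1 <= b^-1 * (n.+1%:R `^ (- b) - n.+2%:R `^ (- b)).
  rewrite /riemannR; have N0 : 0 < n.+1%:R :> R by [].
  have M0 : 0 < n.+2%:R :> R by [].
  rewrite ler_pdivlMl // -powRN.
  have -> : n.+2%:R `^ (- s) = n.+2%:R `^ (- b) * n.+2%:R^-1 :> R.
    rewrite -[in RHS]powR_inv1 // -powRD ?(gt_eqF M0) ?implybT //.
    by rewrite /b opprB addrC addKr.
  have -> : n.+1%:R `^ (- b) = n.+2%:R `^ (- b) * (n.+2%:R / n.+1%:R) `^ b :> R.
    rewrite powRM // ?invr_ge0 // mulrA -powRD ?(gt_eqF M0) ?implybT // addNr powRr0 mul1r.
    by rewrite -[in RHS]powR_inv1 // -powRrM mulN1r.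
  rewrite -[X in _ - X]mulr1 -mulrBr mulrCA ler_wpM2l ?powR_ge0 //.
  (* The ratio [t = (n + 2) / (n + 1)] satisfies [t^b >= 1 + b * ln t], and [ln t = - ln (1 - 1 / (n
     + 2)) >= 1 / (n + 2)]. *)
  rewrite lerBrDl /powR gt_eqF ?divr_gt0 //.
  apply: le_trans (expR_ge1Dx _); rewrite lerD2l (ler_wpM2l (ltW b0)) //.
  rewrite -[n.+2%:R / n.+1%:R]invf_div lnV ?posrE ?divr_gt0 // lerNr.
  have -> : n.+1%:R / n.+2%:R = 1 + - n.+2%:R^-1 :> R.
    apply: (mulIf (lt0r_neq0 M0)); rewrite mulfVK ?gt_eqF // mulrDl mulNr mulVf ?gt_eqF //.
    by rewrite mul1r -[n.+2%:R]natr1 addrK.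
  by apply: le_ln1Dx; rewrite ltrN2 invf_lt1 // ltr1n.
have bound n : series (riemannR s) n.+1 <= 1 + b^-1 * (1 - n.+1%:R `^ (- b)).
  elim: n => [|n IHn].
    by rewrite /series /= big_nat1 /riemannR mulr1n !powR1 subrr mulr0 invr1 addr0.
  rewrite seriesSr; apply: le_trans (lerD IHn (riemannR_le n)) _.
  by rewrite -addrA -mulrDr addrA subrK.
apply: nondecreasing_is_cvgn.
  by apply: nondecreasing_series => k _ _; rewrite invr_ge0 powR_ge0.
exists (1 + b^-1) => _ [[|n] _ <-].
  by rewrite /series /= big_geq // addr_ge0 // invr_ge0 ltW.
apply: le_trans (bound n) _; rewrite lerD2l -[leRHS]mulr1.
by rewrite ler_wpM2l ?invr_ge0 ?(ltW b0) // gerBl powR_ge0.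
Qed.

(** * From iteration complexity to a convergence rate *)

Lemma complexity_rate {R : realType} {d p : nat} (hp : (0 < p)%N) (L alpha r : R)
    (C : problem_class R d) (alg : pCLI R d p) : 0 < L -> 0 < alpha -> 0 < r ->
  complexity_bigO hp C alg (fun eps => (L / eps) `^ (alpha^-1)) ->
  exists k0 M, forall k f xs x, Defs.family C f -> minimizer f xs ->
    generates alg f x -> (forall i, enorm (x 0%N i - xs) <= r) ->
    f (x (k + k0)%N (last_ord hp)) - f xs <= M * riemannR alpha k.
Proof.
move=> L0 al0 r0 /(_ r r0)[c c0 [dl /= dl0 near_dl]].
(* Beyond [kr] iterations the accuracy [eps] chosen below is less than [dl], where the complexity
   bound is available. *)
pose kr := c * 2 / (dl / L) `^ alpha^-1.
have kr0 : 0 < kr by rewrite divr_gt0 ?mulr_gt0 ?powR_gt0 ?divr_gt0.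
exists (Num.truncn kr).+1, (L * (c * 2) `^ alpha) => k f xs x Cf fxs gf init.
(* This [eps] makes the complexity bound equal to [n / 2]; the factor 2 keeps it strictly below [n].
   As [n >= k + 1], [eps] is dominated by a multiple of [riemannR alpha k]. *)
set n := (k + _)%N; pose eps := L * (c * 2 / n%:R) `^ alpha.
have n0 : 0 < n%:R :> R by rewrite ltr0n /n addnS.
have eps0 : 0 < eps by rewrite mulr_gt0 // powR_gt0 // divr_gt0 // mulr_gt0.
have kn : kr < n%:R.
  by apply: lt_le_trans (truncnS_gt kr) _; rewrite ler_nat leq_addl.
have eps_dl : eps < dl.
  have dlE : dl / L = (dl / L) `^ alpha^-1 `^ alpha.
    by rewrite -powRrM mulVf ?gt_eqF // powRr1 // divr_ge0 // ltW.
  rewrite /eps mulrC -ltr_pdivlMr // dlE gt0_ltr_powR ?nnegrE ?powR_ge0 //.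
    by rewrite divr_ge0 // mulr_ge0 // ltW.
  by rewrite ltr_pdivrMr // [ltRHS]mulrC -ltr_pdivrMr // powR_gt0 // divr_gt0.
have : (iteration_complexity hp C alg r eps < n%:R%:E)%E.
  apply: le_lt_trans (near_dl eps _ eps0) _.
    by rewrite /= sub0r normrN gtr0_norm.
  rewrite lte_fin /eps invfM mulrA divff ?gt_eqF // mul1r.
  have cn0 : 0 < c * 2 / n%:R by rewrite divr_gt0 ?mulr_gt0.
  rewrite -(powR_inv1 (powR_ge0 _ alpha)) -!powRrM mulrCA mulfV ?gt_eqF // mulr1.
  rewrite powR_inv1 ?ltW // invf_div mulrCA -[ltRHS]mulr1 ltr_pM2l //.
  by rewrite invfM mulVKf ?gt_eqF // invf_lt1 // ltr1n.
move=> /ereal_inf_lt[_ [K Kspec <-]]; rewrite lte_fin ltr_nat => Kn.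
apply: ltW; apply: lt_le_trans (Kspec f xs x Cf fxs gf init n (ltnW Kn)) _.
rewrite /eps powRM ?invr_ge0 //; last by rewrite mulr_ge0 // ltW.
rewrite mulrA ler_wpM2l //; first by rewrite mulr_ge0 ?powR_ge0 // ltW.
rewrite -powR_inv1 // -powRrM mulN1r powRN lef_pV2 ?posrE ?powR_gt0 //.
by apply: ge0_ler_powR; rewrite ?nnegrE ?(ltW al0) ?(ltW n0) // ler_nat /n addnS ltnS leq_addr.
Qed.

(** * The Euclidean inner product *)

Lemma dotpC {R : realType} {d : nat} (u v : 'cV[R]_d) : dotp u v = dotp v u.
Proof. by apply: eq_bigr => i _; rewrite mulrC. Qed.

Lemma dotpDl {R : realType} {d : nat} (u v w : 'cV[R]_d) :
  dotp (u + v) w = dotp u w + dotp v w.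
Proof. by rewrite -big_split; apply: eq_bigr => i _; rewrite !mxE mulrDl. Qed.

Lemma dotpZl {R : realType} {d : nat} (a : R) (u v : 'cV[R]_d) :
  dotp (a *: u) v = a * dotp u v.
Proof. by rewrite /dotp mulr_sumr; apply: eq_bigr => i _; rewrite !mxE mulrA. Qed.

Lemma dotp_ge0 {R : realType} {d : nat} (u : 'cV[R]_d) : 0 <= dotp u u.
Proof. by apply: sumr_ge0 => i _; rewrite -expr2 sqr_ge0. Qed.

Lemma dotp_ge_coord {R : realType} {d : nat} (u : 'cV[R]_d) i :
  u i 0 ^+ 2 <= dotp u u.
Proof.
rewrite /dotp (bigD1 i) //= expr2 lerDl.
by apply: sumr_ge0 => j _; rewrite -expr2 sqr_ge0.
Qed.

Lemma dotp_delta {R : realType} {d : nat} (u : 'cV[R]_d) i :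
  dotp u (delta_mx i 0) = u i 0.
Proof.
rewrite /dotp (bigD1 i) //= big1 => [|j ji]; rewrite mxE ?eqxx ?mulr1 ?addr0 //.
by rewrite (negbTE ji) mulr0.
Qed.

Lemma enormZ {R : realType} {d : nat} (a : R) (u : 'cV[R]_d) :
  0 <= a -> enorm (a *: u) = a * enorm u.
Proof.
move=> a0; rewrite /enorm dotpZl dotpC dotpZl mulrA -expr2 sqrtrM ?sqr_ge0 //.
by rewrite sqrtr_sqr ger0_norm.
Qed.

(** * Quadratics as members of the class *)

Definition quad {R : realType} {d : nat} (mu : R) (c x : 'cV[R]_d) : R :=
  mu / 2 * dotp (x - c) (x - c).

(** The second-order Taylor expansion is exact; the subgradient, the gradient and convexity are read
    off from it. *)
Lemma quad_expand {R : realType} {d : nat} (mu : R) (c x v : 'cV[R]_d) :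
  quad mu c (x + v) = quad mu c x + mu * dotp (x - c) v + mu / 2 * dotp v v.
Proof.
rewrite /quad addrAC; move: (x - c) => u.
rewrite dotpDl (dotpC u (u + v)) (dotpC v (u + v)) !dotpDl (dotpC v u).
by move: (dotp u u) (dotp u v) (dotp v v) => a b e; field.
Qed.

Lemma quad_minimizer {R : realType} {d : nat} (mu : R) (c : 'cV[R]_d) :
  0 <= mu -> minimizer (quad mu c) c.
Proof.
move=> mu0 y; rewrite /quad subrr {1}/dotp big1 ?mulr0; last first.
  by move=> i _; rewrite mxE mul0r.
by rewrite mulr_ge0 ?divr_ge0 ?dotp_ge0.
Qed.

Lemma quad_subdifferential {R : realType} {d : nat} (mu : R) (c x : 'cV[R]_d) :
  0 <= mu -> subdifferential (quad mu c) x (mu *: (x - c)).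
Proof.
move=> mu0 y; rewrite -[in leRHS](subrKC x y) quad_expand dotpZl lerDl.
by rewrite mulr_ge0 ?divr_ge0 ?dotp_ge0.
Qed.

Lemma quad_differentiable {R : realType} {d : nat} (mu : R) (c x : 'cV[R]_d) :
  differentiable (quad mu c) x.
Proof.
pose g i : 'cV[R]_d -> R := (fun y => y i 0) - cst (c i 0).
have -> : quad mu c = (mu / 2) \*: (\sum_(i < d) g i * g i).
  apply/funext => y; rewrite /quad /dotp /= fct_sumE; congr (_ * _).
  by apply: eq_bigr => i _; rewrite !mxE.
apply/differentiableZ/differentiable_sum => i.
have dg : differentiable (g i) x.
  by apply: differentiableB; [exact: differentiable_coord|exact: differentiable_cst].
exact: differentiableM.
Qed.

Lemma gradient_quad {R : realType} {d : nat} (mu : R) (c x : 'cV[R]_d) :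
  gradient (quad mu c) x = mu *: (x - c).
Proof.
apply/colP => i; rewrite mxE.
set v : 'cV[R]_d := delta_mx i 0.
have -> : (mu *: (x - c)) i 0 = mu * dotp (x - c) v by rewrite dotp_delta mxE.
apply: (cvg_lim (@norm_hausdorff _ _)).
have : mu * dotp (x - c) v + mu / 2 * h * dotp v v @[h --> 0^'] -->
    mu * dotp (x - c) v + mu / 2 * 0 * dotp v v.
  apply: cvg_trans (cvg_app _ (@nbhs_dnbhs _ (0 : R))) _.
  apply: cvgD; first exact: cvg_cst.
  by apply: cvgMr_tmp; apply: cvgMl_tmp; exact: cvg_id.
rewrite mulr0 mul0r addr0; apply: cvg_trans; apply: near_eq_cvg.
near=> h; rewrite /= [_ *: v + x]addrC quad_expand.
have h0 : h != 0 by near: h; exact: nbhs_dnbhs_neq.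
rewrite (dotpC (x - c) (h *: v)) !dotpZl (dotpC v (h *: v)) dotpZl (dotpC v (x - c)).
rewrite /GRing.scale /=; move: (quad mu c x) (dotp (x - c) v) (dotp v v) => A B C.
by field.
Unshelve. all: by end_near.
Qed.

Lemma quad_convex {R : realType} {d : nat} (mu : R) (c : 'cV[R]_d) :
  0 <= mu -> convex_function [set: 'cV[R]_d] (quad mu c).
Proof.
move=> mu0 t x y _ _; rewrite convRE; set s := t%:num.
(* Expanding around [y] in the direction [x - y] reduces the convexity gap to
   [mu / 2 * |x - y|^2 * s * (1 - s)]. *)
have -> : conv t x y = (y : 'cV[R]_d) + s *: ((x : 'cV[R]_d) - y).
  change (s *: x + (1 - s) *: y = (y : 'cV[R]_d) + s *: ((x : 'cV[R]_d) - y) :> 'cV[R]_d).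
  by rewrite scalerBl scale1r scalerBr addrCA.
have s01 : 0 <= s <= 1 by rewrite /s; apply/andP; split.
have xE : quad mu c x = quad mu c (y + (x - y)) by rewrite subrKC.
rewrite xE !quad_expand; move: (x - y : 'cV[R]_d) => u.
rewrite (dotpC (y - c) (s *: u)) !dotpZl (dotpC u (s *: u)) dotpZl (dotpC u (y - c)).
have := dotp_ge0 u; move: (quad mu c y) (dotp (y - c) u) (dotp u u) => A B C C0.
rewrite /unstable.onem -subr_ge0.
have -> : s * (A + mu * B + mu / 2 * C) + (1 - s) * A -
    (A + mu * (s * B) + mu / 2 * (s * (s * C))) = mu / 2 * C * (s * (1 - s)) by field.
case/andP: s01 => s0 s1.
by rewrite !mulr_ge0 // ?divr_ge0 // subr_ge0.
Qed.

Lemma quad_smooth {R : realType} {d : nat} (L mu : R) (c : 'cV[R]_d) :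
  0 <= mu <= L -> smooth L (quad mu c).
Proof.
case/andP=> mu0 muL; split=> [x|x y]; first exact: quad_differentiable.
rewrite !gradient_quad -scalerBr opprD opprK addrACA addNr addr0 enormZ //.
by rewrite ler_wpM2r // sqrtr_ge0.
Qed.

(** * Runs on quadratics, started at the origin *)

Section QuadraticRuns.
Context {R : realType} {d p : nat} (A B : 'I_p -> 'I_p -> 'M[R]_d) (c : 'cV[R]_d).

Local Notation state := ('I_p * 'I_d + unit)%type.

(** Errors are propagated by the blocks [mu * A i j + B i j]; the [inr] column holds the offset
    [\sum_j B i j *m c - c] left when errors replace points. *)
Let step (s s' : state) : {poly R} :=
  match s, s' with
  | inl (i, l), inl (j, m) => (A i j l m) *: 'X + (B i j l m)%:P
  | inl (i, l), inr _ => ((\sum_j B i j *m c) l 0 - c l 0)%:P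
  | inr _, inl _ => 0
  | inr _, inr _ => 1
  end.

(* Errors [x_i^(k) - c] of the run on [quad mu c] started at the origin, as
   polynomials in [mu]; the component [inr tt] is the constant [1], which
   makes the affine recurrence linear. *)
Fixpoint quad_error (k : nat) (s : state) : {poly R} :=
  if k is k'.+1 then \sum_s' step s s' * quad_error k' s'
  else if s is inl (_, l) then (- c l 0)%:P else 1.

Definition quad_run (mu : R) (k : nat) (i : 'I_p) : 'cV[R]_d :=
  c + \col_l (quad_error k (inl (i, l))).[mu].

Lemma quad_run0 mu i : quad_run mu 0 i = 0.
Proof. by apply/colP => l; rewrite !mxE hornerC subrr. Qed.

Lemma quad_runS mu k i : quad_run mu k.+1 i =
  \sum_j (A i j *m (mu *: (quad_run mu k j - c)) + B i j *m quad_run mu k j).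
Proof.
have e1 n : quad_error n (inr tt) = 1.
  elim: n => //= n IHn; rewrite big_sumType /= big1 ?add0r => [|s _]; last by rewrite mul0r.
  by rewrite (big_pred1 tt) => [|[]] //; rewrite mul1r IHn.
apply/colP => l; rewrite !mxE /= big_sumType /= (big_pred1 tt) => [|[]] //.
rewrite e1 mulr1 hornerD hornerC horner_sum addrCA [c l 0 + _]addrC.
rewrite subrK [in RHS]summxE summxE.
pose F j m := (A i j l m * mu + B i j l m) * (quad_error k (inl (j, m))).[mu].
rewrite (eq_bigr (fun s : 'I_p * 'I_d => F s.1 s.2)); last first.
  by case=> j m _ /=; rewrite hornerM hornerD hornerZ hornerX hornerC.
rewrite -pair_bigA -big_split; apply: eq_bigr => j _ /=.
rewrite !mxE -!big_split /=; apply: eq_bigr => m _; rewrite /F !mxE.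
by ring.
Qed.

(** At [mu = 0] the gradient vanishes and the update is linear, so a run started at the origin stays
    there. *)
Lemma quad_error_at0 k i l : (quad_error k (inl (i, l))).[0] = - c l 0.
Proof.
have run0 : quad_run 0 k i = 0.
  elim: k i => [|k IHk] i; first exact: quad_run0.
  rewrite quad_runS big1 // => j _; rewrite scale0r mulmx0 add0r.
  by rewrite (_ : quad_run 0 k j = 0) ?mulmx0.
have := congr1 (fun u : 'cV[R]_d => u l 0) run0; rewrite !mxE.
by move/eqP; rewrite addrC addr_eq0 => /eqP.
Qed.

(** Products of two components evolve linearly under the tensor square of [step]; the square is the
    diagonal pair [(s, s)]. *)
Lemma quad_error_sqr_recurrence s : exists2 q : {poly {poly R}}, q != 0 &
  forall k, shift_op q (fun k => quad_error k s ^+ 2) k = 0.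
Proof.
pose T (u v : state * state) := step u.1 v.1 * step u.2 v.2.
pose y k (u : state * state) := quad_error k u.1 * quad_error k u.2.
have [k u|q qN0 qy] := linear_recurrence T y.
  rewrite /y /= big_distrlr /= pair_bigA; apply: eq_bigr => v _.
  by rewrite /T mulrACA.
exists q => // k; exact: (qy (s, s) k).
Qed.

End QuadraticRuns.

Theorem corollary1 (R : realType) (d p : nat) (hd : (0 < d)%N) (hp : (0 < p)%N)
    (L alpha : R) (hL : 0 < L) (halpha : 0 < alpha) (alg : pCLI R d p) :
  stationary (convex_smooth_class d L) alg ->
  complexity_bigO hp (convex_smooth_class d L) alg
    (fun eps => (L / eps) `^ (alpha^-1)) ->
  alpha <= 1.
Proof.
move=> [A [B stat]] /(complexity_rate hp L alpha 1)[] // k0 [M rate].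
rewrite leNgt; apply/negP => alpha1.
pose l0 : 'I_d := Ordinal hd; pose c : 'cV[R]_d := delta_mx l0 0.
pose s0 : 'I_p * 'I_d + unit := inl (last_ord hp, l0).
pose A0 := A [set L]; pose B0 := B [set L].
have [q qN0 qa] := quad_error_sqr_recurrence A0 B0 c s0.
(* The shift by [k0] makes the rate valid from the first term on and preserves the recurrence. *)
pose a k := quad_error A0 B0 c (k + k0) s0 ^+ 2.
have cvw : cvgn (series ((2 * M) *: riemannR alpha)).
  exact/is_cvg_seriesZ/cvg_riemannR.
apply: (recurrence_not_dominated L a q _ hL qN0 _ _ _ cvw) => [k|k|mu k muL].
- exact: etrans (shift_op_addn q (fun n => quad_error A0 B0 c n s0 ^+ 2) k0 k) (qa _).
- by rewrite /a horner_exp quad_error_at0 mxE !eqxx sqrrN expr1n.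
have /andP[mu0 /ltW muL'] := muL.
rewrite horner_exp mulr_ge0 ?sqr_ge0 ?(ltW mu0) //=.
have fam : Defs.family (convex_smooth_class d L) (quad mu c).
  split; [exact/quad_convex/ltW|apply: quad_smooth|exists c; exact/quad_minimizer/ltW].
  by rewrite ltW.
(* Stationarity enters here: the same [A0] and [B0] serve for every [mu], so a single sequence of
   polynomials describes all runs. *)
have gen : generates alg (quad mu c) (quad_run A0 B0 c mu).
  move=> n i; have [-> ->] := stat _ fam (quad_run A0 B0 c mu 0%N) n.
  eexists; last by rewrite quad_runS.
  by move=> j /=; eexists; first exact/quad_subdifferential/ltW.
have init i : enorm (quad_run A0 B0 c mu 0 i - c) <= 1.
  rewrite quad_run0 sub0r -scaleN1r /enorm dotpZl dotpC dotpZl mulrA mulrNN !mul1r.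
  by rewrite dotp_delta mxE !eqxx sqrtr1.
have := rate k _ _ _ fam (quad_minimizer _ c (ltW mu0)) gen init.
have -> : quad mu c c = 0.
  by rewrite /quad subrr -(scale0r c) dotpZl mul0r mulr0.
rewrite subr0 /quad; set x := quad_run _ _ _ _ _ _ => le_gap.
(* One coordinate of the error bounds the gap [mu / 2 * |x - c|^2] from below, whence the factor 2
   in the dominating sequence. *)
have := dotp_ge_coord (x - c) l0.
have -> : (x - c) l0 0 = (quad_error A0 B0 c (k + k0) s0).[mu].
  by rewrite /x /quad_run addrAC subrr add0r mxE.
move=> le_dotp.
have -> : ((2 * M) *: riemannR alpha) k = 2 * (M * riemannR alpha k).
  by rewrite mulrA.
rewrite -ler_pdivrMl // (le_trans _ le_gap) // mulrA [2^-1 * _]mulrC.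
by apply: ler_wpM2l => //; rewrite divr_ge0 // ltW.
Qed.
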